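(* Let $n\in\mathbb{N}$, $n>0$. For every computable abelian group $G$ and every $b\in G$, $b\neq 0$, there is a $k$-coloring of $G$ of PA degree with no pairwise monochromatic solution to $$(x_1-y_1)+\dots+(x_n-y_n)=b,$$ where $$k=\begin{cases}2n & \text{if } 2\mid \mathrm{ord}(b)\text{ or }\mathrm{ord}(b)=\infty,\\ \left\lceil \dfrac{2np}{p-1}\right\rceil & \text{if }\mathrm{ord}(b)\text{ is odd and }p\text{ is the largest prime divisor of }\mathrm{ord}(b).\end{cases}$$
   Context: A computable group is a group whose underlying set and group operations are computable; $\mathrm{ord}(b)$ is the order of $b$ in $G$. A $k$-coloring of $G$ is any map $c:G\to k=\{0,\dots,k-1\}$. A tuple $(x_1,y_1,\dots,x_n,y_n)\in G^{2n}$ is pairwise monochromatic for $c$ if $c(x_i)=c(y_i)$ for all $i=1,\dots,n$; a pairwise monochromatic solution of an equation is a solution that is pairwise monochromatic for $c$. A tree is a set of finite strings closed under initial segments; a binary tree is a tree contained in $2^{<\mathbb{N}}$. A set (or function) $X$ has PA degree if every computable infinite binary tree has an $X$-computable infinite path.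
   Formalization: ''A k-coloring of PA degree'' is read as: every X of PA degree computes such a k-coloring; the coloring itself need not have PA degree, which is impossible e.g. for finite G or for G = Z, b = 1, n = 1. *)

(* Defs.v *)
(* MathComp, with classical sets from MathComp-Analysis *)
From HB Require Import structures.
From mathcomp Require Import all_boot all_order all_algebra.
From mathcomp Require Import boolp classical_sets functions cardinality.

Set Implicit Arguments.
Unset Strict Implicit.
Unset Printing Implicit Defensive.

Import Order.TTheory GRing.Theory Num.Theory.

Local Open Scope nat_scope.
Local Open Scope classical_set_scope.

(* Total functions N^n -> N recursive relative to the oracle X, following
   Kleene: minimization is only applied to regular functions, so that the class
   consists exactly of the total X-computable functions. *)
Inductive recursive_in (X : nat -> nat) :
    forall n : nat, (n.-tuple nat -> nat) -> Prop :=
| rec_zero n : recursive_in X (fun _ : n.-tuple nat => 0)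
| rec_succ : recursive_in X (fun v : 1.-tuple nat => (thead v).+1)
| rec_oracle : recursive_in X (fun v : 1.-tuple nat => X (thead v))
| rec_proj n (i : 'I_n) : recursive_in X (fun v : n.-tuple nat => tnth v i)
| rec_comp m n (h : m.-tuple nat -> nat) (g : 'I_m -> n.-tuple nat -> nat) :
    recursive_in X h -> (forall i, recursive_in X (g i)) ->
    recursive_in X (fun v : n.-tuple nat => h [tuple g i v | i < m])
| rec_prim n (g : n.-tuple nat -> nat) (h : n.+2.-tuple nat -> nat) :
    recursive_in X g -> recursive_in X h ->
    recursive_in X (fun v : n.+1.-tuple nat =>
      let w : n.-tuple nat := [tuple of behead v] in
      nat_rect (fun _ => nat) (g w) (fun y r => h [tuple of y :: r :: w])
        (thead v))
| rec_min n (g : n.+1.-tuple nat -> nat) (f : n.-tuple nat -> nat) :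
    recursive_in X g ->
    (forall v, g [tuple of f v :: v] = 0 /\
               forall y, y < f v -> g [tuple of y :: v] <> 0) ->
    recursive_in X f.

Definition recursive1_in (X f : nat -> nat) : Prop :=
  recursive_in X (fun v : 1.-tuple nat => f (thead v)).

Definition recursive2_in (X : nat -> nat) (f : nat -> nat -> nat) : Prop :=
  recursive_in X (fun v : 2.-tuple nat => f (tnth v ord0) (tnth v ord_max)).

Definition no_oracle : nat -> nat := fun=> 0.

Definition computable_set (A : set nat) : Prop :=
  exists chi : nat -> bool,
    recursive1_in no_oracle (fun m => chi m : nat) /\ forall m, A m <-> chi m.

(* Bijective base 2 numeration, a bijection from finite binary strings to nat. *)
Definition string_code (s : seq bool) : nat :=
  foldr (fun (a : bool) m => (m.*2 + a).+1) 0 s.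

Definition binary_tree (T : set (seq bool)) : Prop :=
  forall s t : seq bool, prefix s t -> T t -> T s.

Definition infinite_path (T : set (seq bool)) (f : nat -> bool) : Prop :=
  forall m, T (mkseq f m).

(* A set of naturals is represented by its characteristic function. *)
Definition PA_degree (X : nat -> nat) : Prop :=
  forall T : set (seq bool),
    binary_tree T -> infinite_set T -> computable_set (string_code @` T) ->
    exists2 f : nat -> bool,
      infinite_path T f & recursive1_in X (fun m => f m : nat).

(* The map e identifies G with a subset of the natural numbers. *)
Definition computable_group (G : zmodType) (e : G -> nat) : Prop :=
  [/\ injective e,
      computable_set (range e),
      exists2 add, recursive2_in no_oracle add &
        forall x y : G, add (e x) (e y) = e (x + y)%R
    & exists2 opp, recursive1_in no_oracle opp &
        forall x : G, opp (e x) = e (- x)%R].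

Definition computable_coloring_in (X : nat -> nat) (G : zmodType)
    (e : G -> nat) (k : nat) (c : G -> 'I_k) : Prop :=
  exists2 f, recursive1_in X f & forall x : G, f (e x) = c x.

(* None stands for infinite order. *)
Definition ord (G : zmodType) (b : G) : option nat :=
  match pselect (exists m, (0 < m) && (b *+ m == 0)%R) with
  | left ex => Some (ex_minn ex)
  | right _ => None
  end.

Definition num_colors (n : nat) (o : option nat) : nat :=
  match o with
  | None => 2 * n
  | Some m =>
    if 2 %| m then 2 * n
    else let p := max_pdiv m in
         `|Num.ceil ((2 * n * p)%:R / (p%:R - 1) : rat)%R|%N
  end.

Definition pairwise_monochromatic (G : Type) (k n : nat) (c : G -> 'I_k)
    (x y : 'I_n -> G) : Prop :=
  forall i, c (x i) = c (y i).

(* Main.v *)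
(* Classically, such colourings come from characters. Q/Z is divisible, so some
   chi : G -> Q/Z sends b to a point t whose distance to 0 is 1/2 (even or
   infinite order) or (p - 1)/(2p) (odd order). Colour x by which of the k
   half-open arcs of length 1/k contains chi(x): n monochromatic differences
   then add up to a value of chi at distance less than n/k <= |t| from 0, so they
   do not sum to b.
   Such a colouring need not be computable, but the colourings without solution
   are the infinite paths of a computable binary tree, whose nodes are the finite
   strings in which no solution is visible yet; a PA degree computes a path. *)
Require Import Defs.
From mathcomp Require Import all_boot all_order all_algebra.
From mathcomp Require Import boolp classical_sets functions cardinality.
From mathcomp Require Import zify ring lra.

Set Implicit Arguments.
Unset Strict Implicit.
Unset Printing Implicit Defensive.

Import Order.TTheory GRing.Theory Num.Theory.

(** * Closure properties of computable functions *)

(** Arguments form a plain list, of which only length [n] matters: variables are read by [nth] and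
    contexts extended by [cons], without dependent tuples. *)
Definition computable_in (X : nat -> nat) (n : nat) (f : seq nat -> nat) :=
  recursive_in X (fun v : n.-tuple nat => f v).

Section Computability.

Variable X : nat -> nat.
Implicit Types (n : nat) (f g h : seq nat -> nat).

Lemma computable_ext n f g : (forall v, size v = n -> f v = g v) ->
  computable_in X n f -> computable_in X n g.
Proof.
move=> fg; rewrite /computable_in.
suff -> : (fun v : n.-tuple nat => f v) = (fun v : n.-tuple nat => g v) by [].
by apply/funext => v; rewrite fg ?size_tuple.
Qed.

Lemma computable_var n i : i < n -> computable_in X n (fun v => nth 0 v i).
Proof.
move=> lt_in; rewrite /computable_in.
suff -> : (fun v : n.-tuple nat => nth 0 v i) =
          (fun v : n.-tuple nat => tnth v (Ordinal lt_in)) by exact: rec_proj.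
by apply/funext => v; rewrite (tnth_nth 0).
Qed.

Lemma computable_comp m n h (g : nat -> seq nat -> nat) :
  computable_in X m h -> (forall i, i < m -> computable_in X n (g i)) ->
  computable_in X n (fun v => h (mkseq (g^~ v) m)).
Proof.
move=> Ch Cg; rewrite /computable_in.
have := rec_comp (g := fun (i : 'I_m) (v : n.-tuple nat) => g i v) Ch
  (fun i => Cg i (ltn_ord i)).
congr (recursive_in X); apply/funext => v; congr h; rewrite /=.
by rewrite /mkseq -val_enum_ord -map_comp.
Qed.

Lemma computable_comp1 (h : nat -> nat) n f : recursive1_in X h ->
  computable_in X n f -> computable_in X n (fun v => h (f v)).
Proof.
move=> Ch Cf; have Ch' : computable_in X 1 (fun v => h (nth 0 v 0)).
  move: Ch; congr (recursive_in X); apply/funext => v.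
  by rewrite /thead (tnth_nth 0).
exact: (computable_comp (g := fun=> f) Ch').
Qed.

Lemma computable_comp2 (h : nat -> nat -> nat) n f g : recursive2_in X h ->
  computable_in X n f -> computable_in X n g ->
  computable_in X n (fun v => h (f v) (g v)).
Proof.
move=> Ch Cf Cg.
have Ch' : computable_in X 2 (fun v => h (nth 0 v 0) (nth 0 v 1)).
  by move: Ch; congr (recursive_in X); apply/funext => v; rewrite !(tnth_nth 0).
by apply: (computable_comp (g := fun i => if i is 0 then f else g) Ch') => -[|].
Qed.

Lemma recursive1P (h : nat -> nat) :
  computable_in X 1 (fun v => h (nth 0 v 0)) -> recursive1_in X h.
Proof.
by congr (recursive_in X); apply/funext => v; rewrite /thead (tnth_nth 0).
Qed.

Lemma recursive2P (h : nat -> nat -> nat) :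
  computable_in X 2 (fun v => h (nth 0 v 0) (nth 0 v 1)) -> recursive2_in X h.
Proof. by congr (recursive_in X); apply/funext => v; rewrite !(tnth_nth 0). Qed.

Lemma computable_const n c : computable_in X n (fun=> c).
Proof.
elim: c => [|c IHc]; first exact: rec_zero.
have S1 : recursive1_in X S by exact: rec_succ.
exact: (computable_comp1 S1 IHc).
Qed.

Lemma mkseq_nth_id n (v : seq nat) : size v = n ->
  mkseq (fun i => nth 0 v i) n = v.
Proof. by move=> <-; exact: mkseq_nth. Qed.

(** [rec_prim] recurses on the first entry; here the number of rounds is computed from [v], by
    composing with the list [f v :: v]. The step function sees the counter, the accumulator, then
    [v]. *)
Lemma computable_primrec n f g h :
  computable_in X n f -> computable_in X n g -> computable_in X n.+2 h ->
  computable_in X n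
    (fun v => nat_rect (fun=> nat) (g v) (fun y r => h (y :: r :: v)) (f v)).
Proof.
move=> Cf Cg Ch.
have Crec : computable_in X n.+1 (fun v => nat_rect (fun=> nat) (g (behead v))
    (fun y r => h (y :: r :: behead v)) (nth 0 v 0)).
  have := rec_prim Cg Ch; congr (recursive_in X); apply/funext => v /=.
  by rewrite /thead (tnth_nth 0).
apply: computable_ext (computable_comp
  (g := fun i v => nth 0 (f v :: v) i) Crec _) => [v sv /=|[|i] lt_in //=].
- rewrite /mkseq /= -[1]addn0 iotaDl -map_comp.
  rewrite (_ : map _ _ = v) //; exact: mkseq_nth_id.
- exact: computable_var.
Qed.

Lemma computable_iter n f g (h : nat -> nat) :
  computable_in X n f -> computable_in X n g -> recursive1_in X h ->
  computable_in X n (fun v => iter (f v) h (g v)).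
Proof.
move=> Cf Cg Ch.
have Ch' : computable_in X n.+2 (fun v => h (nth 0 v 1)).
  by apply: computable_comp1 => //; exact: computable_var.
apply: computable_ext (computable_primrec Cf Cg Ch') => v _.
by elim: (f v) => //= m ->.
Qed.

Lemma computable_add n f g : computable_in X n f -> computable_in X n g ->
  computable_in X n (fun v => f v + g v).
Proof.
move=> Cf Cg; have S1 : recursive1_in X S by exact: rec_succ.
apply: computable_ext (computable_iter Cf Cg S1) => v _.
by elim: (f v) => //= m ->.
Qed.

Lemma computable_mul n f g : computable_in X n f -> computable_in X n g ->
  computable_in X n (fun v => f v * g v).
Proof.
move=> Cf Cg; have add2 : recursive2_in X addn.
  by apply: recursive2P; apply: computable_add; exact: computable_var.
have Ch : computable_in X n.+2 (fun v => g (behead (behead v)) + nth 0 v 1).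
  apply: computable_add; last exact: computable_var.
  (* Weakening: [g] must skip the counter and the accumulator. *)
  apply: computable_ext (computable_comp (g := fun i v => nth 0 v i.+2) Cg _).
    move=> [|x [|y v]] //= [sv]; congr g; exact: mkseq_nth_id.
  by move=> i lt_in; exact: computable_var.
apply: computable_ext (computable_primrec Cf (computable_const n 0) Ch) => v _.
by elim: (f v) => //= m ->; rewrite mulSn.
Qed.

(** The step returns the counter, which in the last round is the predecessor. *)
Lemma recursive1_pred : recursive1_in X predn.
Proof.
apply: recursive1P; apply: computable_ext (computable_primrec
  (computable_var (ltn0Sn 0)) (computable_const 1 0)
  (computable_var (ltn0Sn 2))) => v _.
by case: (nth 0 v 0).
Qed.

Lemma computable_sub n f g : computable_in X n f -> computable_in X n g ->
  computable_in X n (fun v => f v - g v).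
Proof.
move=> Cf Cg; apply: computable_ext (computable_iter Cg Cf recursive1_pred).
by move=> v _; elim: (g v) => [|m /= ->]; rewrite ?subn0 ?subnS.
Qed.

Lemma computable_neg n (p : seq nat -> bool) :
  computable_in X n p -> computable_in X n (fun v => ~~ p v).
Proof.
move=> Cp; apply: computable_ext (computable_sub (computable_const n 1) Cp).
by move=> v _; case: (p v).
Qed.

Lemma computable_and n (p q : seq nat -> bool) :
  computable_in X n p -> computable_in X n q ->
  computable_in X n (fun v => p v && q v).
Proof.
move=> Cp Cq; apply: computable_ext (computable_mul Cp Cq) => v _.
by rewrite mulnb.
Qed.

Lemma computable_or n (p q : seq nat -> bool) :
  computable_in X n p -> computable_in X n q ->
  computable_in X n (fun v => p v || q v).
Proof.
move=> Cp Cq; apply: computable_ext (computable_neg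
  (computable_and (computable_neg Cp) (computable_neg Cq))) => v _.
by rewrite negb_and !negbK.
Qed.

Lemma computable_eq0 n f : computable_in X n f ->
  computable_in X n (fun v => f v == 0).
Proof.
move=> Cf; apply: computable_ext (computable_sub (computable_const n 1) Cf).
by move=> v _; case: (f v).
Qed.

Lemma computable_eq n f g : computable_in X n f -> computable_in X n g ->
  computable_in X n (fun v => f v == g v).
Proof.
move=> Cf Cg; apply: computable_ext
  (computable_eq0 (computable_add (computable_sub Cf Cg) (computable_sub Cg Cf))).
by move=> v _; rewrite addn_eq0 !subn_eq0 -eqn_leq.
Qed.

Lemma computable_odd n f : computable_in X n f ->
  computable_in X n (fun v => odd (f v)).
Proof.
move=> Cf; have neg1 : recursive1_in X (fun m => 1 - m).
  apply: recursive1P; apply: computable_sub; first exact: computable_const.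
  exact: computable_var.
apply: computable_ext (computable_iter Cf (computable_const n 0) neg1) => v _.
by elim: (f v) => //= m ->; case: (odd m).
Qed.

Lemma computable_half n f : computable_in X n f ->
  computable_in X n (fun v => (f v)./2).
Proof.
move=> Cf; have Ch : computable_in X n.+2 (fun v => odd (nth 0 v 0) + nth 0 v 1).
  by apply: computable_add; try apply: computable_odd; exact: computable_var.
apply: computable_ext (computable_primrec Cf (computable_const n 0) Ch) => v _.
by elim: (f v) => //= m ->; rewrite uphalf_half.
Qed.

Lemma computable_big_sum n m (f : nat -> seq nat -> nat) :
  (forall i, computable_in X n (f i)) ->
  computable_in X n (fun v => \sum_(i < m) f i v).
Proof.
move=> Cf; elim: m => [|m IHm].
  by apply: computable_ext (computable_const n 0) => v _; rewrite big_ord0.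
apply: computable_ext (computable_add IHm (Cf m)) => v _.
by rewrite big_ord_recr.
Qed.

(** Bounded search: the recursion keeps the disjunction of the tests made so far, and the bound
    variable becomes the new head of the argument list. *)
Lemma computable_has n f (p : seq nat -> bool) :
  computable_in X n f -> computable_in X n.+1 p ->
  computable_in X n (fun v => has (fun y => p (y :: v)) (iota 0 (f v))).
Proof.
move=> Cf Cp.
have Cp' : computable_in X n.+2 (fun v => p (nth 0 v 0 :: behead (behead v))).
  apply: computable_ext (computable_comp
    (g := fun i v => nth 0 v (if i is 0 then 0 else i.+1)) Cp _).
    move=> [|x [|y v]] //= [sv]; congr (p _ : nat); rewrite /mkseq /=; congr cons.
    rewrite -[1]addn0 iotaDl -map_comp; exact: mkseq_nth_id.
  by case=> [|i] lt_in; exact: computable_var.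
have Ch : computable_in X n.+2
    (fun v => (nth 0 v 1 != 0) || p (nth 0 v 0 :: behead (behead v))).
  apply: computable_or => //; apply/computable_neg/computable_eq0.
  exact: computable_var.
apply: computable_ext (computable_primrec Cf (computable_const n 0) Ch) => v _.
elim: (f v) => // m IHm; rewrite -[in RHS]addn1 iotaD has_cat [LHS]/= IHm.
by rewrite eqb0 negbK /= orbF.
Qed.

End Computability.

(** * The tree of partial colourings *)

Section StringDecoding.

Implicit Types (s : seq bool) (i m : nat).

(** For [m.+1], the parity of [m] is the first letter and the half of [m] codes the rest. *)
Lemma string_code_surj m : exists s, string_code s = m.
Proof.
elim/ltn_ind: m => -[_|m IHm]; first by exists [::].
have [|s codes] := IHm m./2; first by rewrite ltnS leq_half_double; lia.
by exists (odd m :: s); rewrite /= codes addnC odd_double_half.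
Qed.

(* On codes, [predn] followed by [half] deletes the first letter. *)
Definition code_drop i m := iter i (fun m => m.-1./2) m.

Lemma code_dropE i s : code_drop i (string_code s) = string_code (drop i s).
Proof.
elim: i s => [|i IHi] s; first by rewrite drop0.
rewrite /code_drop iterSr; case: s => [|a s]; first exact: (IHi [::]).
rewrite [string_code _]/= succnK addnC half_bit_double; exact: IHi.
Qed.

(** Past the end of the string the remaining code is 0 and the result is [false], in agreement with
    the default of [nth] below. *)
Definition code_bit i m := odd (code_drop i m).-1.

Lemma code_bitE i s : code_bit i (string_code s) = nth false s i.
Proof.
rewrite /code_bit code_dropE -[i in RHS]addn0 -nth_drop.
by case: (drop i s) => //= a t; rewrite oddD odd_double oddb.
Qed.

(** Only the empty string has code 0; this makes length tests computable on codes. *)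
Lemma code_drop_neq0 i s : (code_drop i (string_code s) != 0) = (i < size s).
Proof.
rewrite code_dropE -subn_gt0 -size_drop.
by case: (drop i s).
Qed.

Lemma size_string_code s : size s <= string_code s.
Proof.
elim: s => //= a s IHs; rewrite ltnS (leq_trans IHs) //.
by rewrite -addnn -addnA leq_addr.
Qed.

Lemma computable_code_drop X n f g :
  computable_in X n f -> computable_in X n g ->
  computable_in X n (fun v => code_drop (f v) (g v)).
Proof.
move=> Cf Cg; apply: computable_iter => //; apply: recursive1P.
apply: computable_half; apply: computable_comp1; last exact: computable_var.
exact: recursive1_pred.
Qed.

Lemma computable_code_bit X n f g :
  computable_in X n f -> computable_in X n g ->
  computable_in X n (fun v => code_bit (f v) (g v)).
Proof.
move=> Cf Cg; apply: computable_odd.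
exact: computable_comp1 (recursive1_pred X) (computable_code_drop Cf Cg).
Qed.

End StringDecoding.

(** * Sums of [n] differences of related pairs *)

Section DifferenceSums.

Variable G : zmodType.
Implicit Types (E : G -> G -> Prop) (x y z : G).

(** One difference is peeled off at a time, a form that a decision procedure on codes can follow.
    The relation [E] will be equality of colours, either full or as far as a finite string shows
    it. *)
Fixpoint diff_sum E (n : nat) (z : G) : Prop :=
  if n is n'.+1 then exists x y, E x y /\ diff_sum E n' (z - (x - y))%R
  else z = 0%R.

Lemma diff_sumP E n z :
  diff_sum E n z <->
  exists x y : 'I_n -> G, (forall i, E (x i) (y i)) /\
    (\sum_(i < n) (x i - y i) = z)%R.
Proof.
elim: n z => [|n IHn] z /=.
  split=> [->|[x [y [_ <-]]]]; last by rewrite big_ord0.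
  by exists (fun=> 0%R), (fun=> 0%R); split=> [[]//|]; rewrite big_ord0.
split=> [[x [y [Exy /IHn[x' [y' [Exy' sumz]]]]]]|[x [y [Exy <-]]]].
  exists (fun i => if unlift ord0 i is Some j then x' j else x),
         (fun i => if unlift ord0 i is Some j then y' j else y).
  split=> [i|]; first by case: unliftP.
  rewrite big_ord_recl unlift_none addrC.
  under eq_bigr do rewrite liftK.
  by rewrite sumz subrK.
exists (x ord0), (y ord0); split=> //; apply/IHn.
exists (fun i => x (lift ord0 i)), (fun i => y (lift ord0 i)); split=> //.
by rewrite big_ord_recl addrAC subrr add0r.
Qed.

Lemma sub_diff_sum E E' n z : (forall x y, E x y -> E' x y) ->
  diff_sum E n z -> diff_sum E' n z.
Proof.
move=> sEE' /diff_sumP[x [y [Exy sumz]]]; apply/diff_sumP.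
by exists x, y; split=> // i; apply: sEE'.
Qed.

Lemma diff_sum_bigcup (E : nat -> G -> G -> Prop) n z :
  (forall m m' x y, m <= m' -> E m x y -> E m' x y) ->
  diff_sum (fun x y => exists m, E m x y) n z ->
  exists m, diff_sum (E m) n z.
Proof.
move=> homoE; elim: n z => [|n IHn] z /=; first by exists 0.
move=> [x [y [[m Exy] /IHn[m' sumz]]]]; exists (maxn m m'), x, y; split.
  exact: homoE (leq_maxl _ _) Exy.
by apply: sub_diff_sum sumz => u v; apply/homoE/leq_maxr.
Qed.

End DifferenceSums.

(** * Colourings as paths of a binary tree *)

Section ColoringTree.

Variables (G : zmodType) (e : G -> nat) (k : nat).
Hypothesis (G_computable : computable_group e) (k_gt0 : 0 < k).

(* A colour is encoded in unary by a block of k - 1 bits. *)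
Definition block_color (f : nat -> bool) (a : nat) : nat :=
  \sum_(j < k.-1) f (a * k + j).

(** The unary encoding ensures that every bit sequence, hence every path, decodes to valid
    colours. *)
Lemma block_color_lt f a : block_color f a < k.
Proof.
rewrite /block_color -[ltnRHS](prednK k_gt0) ltnS.
rewrite -[leqRHS]card_ord -sum1_card leq_sum // => i _; exact: leq_b1.
Qed.

Lemma eq_block_color f g a : (forall i, i < a.+1 * k -> f i = g i) ->
  block_color f a = block_color g a.
Proof.
move=> eq_fg; apply: eq_bigr => j _; rewrite eq_fg // mulSn addnC ltn_add2r.
exact: leq_trans (ltn_ord j) (leq_pred k).
Qed.

Lemma block_color_surj (c : nat -> 'I_k) : exists f, block_color f =1 c.
Proof.
(* Block [a] consists of [c a] ones followed by zeros. *)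
exists (fun i => i %% k < c (i %/ k)) => a.
rewrite /block_color; transitivity (\sum_(j < k.-1) (j < c a : nat)).
  apply: eq_bigr => j _.
  have lt_jk : j < k by rewrite (leq_trans (ltn_ord j)) ?leq_pred.
  by rewrite modnMDl divnMDl // modn_small // divn_small // addn0.
have le_ck : c a <= k.-1 by rewrite -ltnS prednK.
(* Writing [c a] as a minimum gives a statement that holds for every number of summands and admits
   induction. *)
rewrite -[RHS](minn_idPl le_ck); elim: k.-1 => [|m IHm].
  by rewrite big_ord0 minn0.
by rewrite big_ord_recr /= {}IHm; lia.
Qed.

(** Both blocks must lie inside [s], so that the missing bits never create an agreement and an
    extension of [s] never destroys one. *)
Definition seen_same_color (s : seq bool) (x y : G) : bool :=
  [&& (e x).+1 * k < size s, (e y).+1 * k < size s &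
      block_color (nth false s) (e x) == block_color (nth false s) (e y)].

Definition coloring_tree (n : nat) (b : G) : set (seq bool) :=
  [set s | ~ diff_sum (seen_same_color s) n b]%classic.

Lemma seen_same_color_prefix s t x y :
  prefix s t -> seen_same_color s x y -> seen_same_color t x y.
Proof.
case/prefixP=> u ->{t} /and3P[lex ley eqxy].
have cat_color a : a.+1 * k < size s ->
    block_color (nth false (s ++ u)) a = block_color (nth false s) a.
  move=> lea; apply: eq_block_color => i lti.
  by rewrite nth_cat (ltn_trans lti).
by rewrite /seen_same_color !cat_color // eqxy size_cat !ltn_addr.
Qed.

Lemma binary_tree_coloring_tree n b : binary_tree (coloring_tree n b).
Proof.
move=> s t st Tt Ts; apply: Tt; apply: sub_diff_sum Ts => x y.
exact: seen_same_color_prefix.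
Qed.

Lemma seen_same_color_mkseq f m x y :
  seen_same_color (mkseq f m) x y =
  [&& (e x).+1 * k < m, (e y).+1 * k < m &
      block_color f (e x) == block_color f (e y)].
Proof.
have mkseq_color a : a.+1 * k < m ->
    block_color (nth false (mkseq f m)) a = block_color f a.
  move=> lea; apply: eq_block_color => i lti.
  by rewrite nth_mkseq ?(ltn_trans lti).
rewrite /seen_same_color size_mkseq; apply: andb_id2l => ltx.
by apply: andb_id2l => lty; rewrite !mkseq_color.
Qed.

(** A solution uses finitely many blocks, so some initial segment of the path already shows it;
    conversely, what a segment shows holds for the whole path. *)
Lemma infinite_path_coloring_tree n b f :
  infinite_path (coloring_tree n b) f <->
  ~ diff_sum (fun x y => block_color f (e x) = block_color f (e y)) n b.
Proof.
split=> [Tf sumb|nf m]; last first.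
  apply: contra_not nf; apply: sub_diff_sum => x y.
  by rewrite seen_same_color_mkseq => /and3P[_ _ /eqP].
have [m] : exists m, diff_sum (seen_same_color (mkseq f m)) n b; last exact: Tf.
apply: diff_sum_bigcup.
  move=> m m' x y le_mm'; apply: seen_same_color_prefix.
  by rewrite -(subnKC le_mm') /mkseq iotaD map_cat prefix_prefix.
(* This length reaches beyond both blocks. *)
apply: sub_diff_sum sumb => x y eqxy; exists ((maxn (e x) (e y)).+1 * k).+1.
rewrite seen_same_color_mkseq eqxy !ltnS !leq_pmul2r // !ltnS.
by rewrite leq_maxl leq_maxr eqxx.
Qed.

(** The initial segments of [f] have unbounded length. *)
Lemma infinite_path_infinite (T : set (seq bool)) f :
  infinite_path T f -> infinite_set T.
Proof.
move=> Tf /finite_seqP[r Tr].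
have := Tf (\max_(s <- r) size s).+1; rewrite Tr /=.
move=> /(@leq_bigmax_seq _ r xpredT size)/(_ isT).
by rewrite size_mkseq ltnn.
Qed.

(** * Decidability of the tree *)

Section Decision.

Variables (X : nat -> nat) (add : nat -> nat -> nat) (opp : nat -> nat).
Variable chi : nat -> bool.
Hypotheses (Cadd : recursive2_in X add) (Copp : recursive1_in X opp)
  (Cchi : recursive1_in X chi).
Hypotheses (addE : forall x y, add (e x) (e y) = e (x + y)%R)
  (oppE : forall x, opp (e x) = e (- x)%R)
  (chiE : forall a, (range e)%classic a <-> chi a).

(** The tests by [chi] discard numbers that code no group element, where [add] and [opp] are
    arbitrary. *)
Definition code_same_color (m a a' : nat) : bool :=
  [&& chi a, chi a', code_drop (a.+1 * k) m != 0, code_drop (a'.+1 * k) m != 0 &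
      block_color (code_bit^~ m) a == block_color (code_bit^~ m) a'].

Lemma code_same_colorE s x y :
  code_same_color (string_code s) (e x) (e y) = seen_same_color s x y.
Proof.
have chi1 z : chi (e z) by apply/chiE; exists z.
rewrite /code_same_color !chi1 !code_drop_neq0 /=.
suff E a : block_color (code_bit^~ (string_code s)) a =
           block_color (nth false s) a by rewrite !E.
by apply: eq_block_color => i _; exact: code_bitE.
Qed.

(* The entries of the argument are the code of a string, then that of a group
   element. *)
Fixpoint code_diff_sum (n : nat) (v : seq nat) : bool :=
  if n is n'.+1 then
    has (fun x => has (fun y =>
        code_same_color (nth 0 v 0) x y &&
        code_diff_sum n' [:: nth 0 v 0; add (nth 0 v 1) (opp (add x (opp y)))])
      (iota 0 (nth 0 v 0))) (iota 0 (nth 0 v 0))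
  else nth 0 v 1 == e 0%R.

(** The bounded search is complete: every element visible in [s] has a code below the length of [s],
    which is at most [string_code s]. *)
Lemma code_diff_sumP n s z :
  code_diff_sum n [:: string_code s; e z] <-> diff_sum (seen_same_color s) n z.
Proof.
have [inj_e _ _ _] := G_computable.
elim: n z => [|n IHn] z.
  by split=> [/eqP/inj_e|/= ->].
rewrite [code_diff_sum _ _]/=; split.
  case/hasP=> a _ /hasP[a' _ /andP[]].
  move=> /[dup] /and3P[/chiE[x _ <-] /chiE[y _ <-] _].
  by rewrite code_same_colorE oppE addE oppE addE => xy /IHn; exists x, y.
case=> x [y [xy sumz]].
have lt_code a : a.+1 * k < size s -> a \in iota 0 (string_code s).
  move=> lta; rewrite mem_iota add0n /= (leq_trans _ (size_string_code s)) //.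
  by apply: leq_ltn_trans lta; rewrite (leq_trans (leqnSn a)) // leq_pmulr.
have /and3P[ltx lty _] := xy.
apply/hasP; exists (e x); first exact: lt_code.
apply/hasP; exists (e y); first exact: lt_code.
by rewrite code_same_colorE xy oppE addE oppE addE; apply/IHn.
Qed.

Lemma computable_code_same_color n f g h : computable_in X n f ->
  computable_in X n g -> computable_in X n h ->
  computable_in X n (fun v => code_same_color (f v) (g v) (h v)).
Proof.
move=> Cf Cg Ch.
have Cdrop g' : computable_in X n g' ->
    computable_in X n (fun v => code_drop ((g' v).+1 * k) (f v) != 0).
  move=> Cg'; apply/computable_neg/computable_eq0/computable_code_drop => //.
  apply: computable_mul; last exact: computable_const.
  by apply: computable_comp1 => //; exact: rec_succ.
have Ccolor g' : computable_in X n g' ->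
    computable_in X n (fun v => block_color (code_bit^~ (f v)) (g' v)).
  move=> Cg'; apply: (computable_big_sum _
    (f := fun i v => code_bit (g' v * k + i) (f v))) => i.
  apply: computable_code_bit => //.
  apply: computable_add; last exact: computable_const.
  by apply: computable_mul; last exact: computable_const.
have Ceq := computable_eq (Ccolor _ Cg) (Ccolor _ Ch).
exact: (computable_and (computable_comp1 Cchi Cg)
  (computable_and (computable_comp1 Cchi Ch)
  (computable_and (Cdrop _ Cg) (computable_and (Cdrop _ Ch) Ceq)))).
Qed.

Lemma computable_code_diff_sum n : computable_in X 2 (code_diff_sum n).
Proof.
elim: n => [|n IHn].
  by apply: computable_eq; [exact: computable_var|exact: computable_const].
(* The entries of [v] are the candidates for [y] and [x], then the code of the string and that of
   the target. *)
have Cbody : computable_in X 4 (fun v =>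
    code_same_color (nth 0 v 2) (nth 0 v 1) (nth 0 v 0) &&
    code_diff_sum n [:: nth 0 v 2;
      add (nth 0 v 3) (opp (add (nth 0 v 1) (opp (nth 0 v 0))))]).
  apply: computable_and.
    by apply: computable_code_same_color; exact: computable_var.
  apply: (computable_comp (g := fun i v => if i is 0 then nth 0 v 2 else
    add (nth 0 v 3) (opp (add (nth 0 v 1) (opp (nth 0 v 0))))) IHn) => -[_|i _].
    exact: computable_var.
  apply: computable_comp2; [by []|exact: computable_var|].
  apply: computable_comp1; first by [].
  apply: computable_comp2; [by []|exact: computable_var|].
  by apply: computable_comp1; [|exact: computable_var].
exact: (computable_has (computable_var _ (isT : 0 < 2))
  (computable_has (computable_var _ (isT : 1 < 3)) Cbody)).
Qed.

Lemma computable_coloring_tree n b :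
  exists chiT : nat -> bool, recursive1_in X (fun m => chiT m : nat) /\
    forall m, (string_code @` coloring_tree n b)%classic m <-> chiT m.
Proof.
exists (fun m => ~~ code_diff_sum n [:: m; e b]); split.
  apply/recursive1P/computable_neg.
  apply: (computable_comp (g := fun i v => if i is 0 then nth 0 v 0 else e b)
    (computable_code_diff_sum n)) => -[_|i _].
    exact: computable_var.
  exact: computable_const.
move=> m; split=> [[s Ts <-]|]; first by apply/negP => /code_diff_sumP.
have [s <-] := string_code_surj m => /negP Ts.
by exists s => // sumb; apply: Ts; apply/code_diff_sumP.
Qed.

End Decision.

(** The given colouring only serves to show that the tree is infinite; the resulting one is read off
    a path computed from [X]. *)
Lemma PA_degree_coloring X n b : PA_degree X ->
  (exists c : G -> 'I_k, ~ diff_sum (fun x y => c x = c y) n b) ->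
  exists2 c : G -> 'I_k, computable_coloring_in X e c &
    ~ diff_sum (fun x y => c x = c y) n b.
Proof.
move=> PA_X [c nc].
have [inj_e [chi [Cchi chiE]] [add Cadd addE] [opp Copp oppE]] := G_computable.
have [f cf] : exists f, forall x, block_color f (e x) = c x.
  (* Numbers outside the range of [e] get the default colour 0. *)
  have [f cf] := block_color_surj (fun a =>
    if pselect (exists x, e x = a) is left ex then c (projT1 (cid ex))
    else Ordinal k_gt0).
  exists f => x; rewrite cf; case: pselect => [ex|[]]; last by exists x.
  by case: cid => y /= /inj_e ->.
have Tf : infinite_path (coloring_tree n b) f.
  apply/infinite_path_coloring_tree; apply: contra_not nc.
  by apply: sub_diff_sum => x y; rewrite !cf => /val_inj.
have [g Tg Cg] := PA_X _ (@binary_tree_coloring_tree n b)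
  (infinite_path_infinite Tf)
  (computable_coloring_tree Cadd Copp Cchi addE oppE chiE n b).
exists (fun x => Ordinal (block_color_lt g (e x))).
  exists (block_color g) => //; apply: recursive1P.
  apply: (computable_big_sum _ (f := fun j v => g (nth 0 v 0 * k + j))) => j.
  apply: (computable_comp1 Cg).
  apply: computable_add; last exact: computable_const.
  by apply: computable_mul; [exact: computable_var|exact: computable_const].
move/infinite_path_coloring_tree: Tg; apply: contra_not.
by apply: sub_diff_sum => x y [].
Qed.

End ColoringTree.

(** * Characters *)

Section SubgroupExtension.

Local Open Scope classical_set_scope.
Local Open Scope ring_scope.

Variable G : zmodType.
Implicit Types (A : set (G * rat)) (x : G) (q r : rat) (j : int).

(** When nonempty, such a set is a subgroup of [G * rat]. *)
Definition sub_closed A := forall u v, A u -> A v -> A (u - v).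

Section SubClosed.

Variable A : set (G * rat).
Hypotheses (subA : sub_closed A) (A_neq0 : A !=set0).

Lemma sub_closed0 : A 0.
Proof. by have [u Au] := A_neq0; rewrite -(subrr u); exact: subA. Qed.

Lemma sub_closedN u : A u -> A (- u).
Proof. by rewrite -sub0r; apply: subA; exact: sub_closed0. Qed.

Lemma sub_closedD u v : A u -> A v -> A (u + v).
Proof. by move=> Au /sub_closedN Av; rewrite -[v]opprK; exact: subA. Qed.

Lemma sub_closedMz u j : A u -> A (u *~ j).
Proof.
move=> Au; have An n : A (u *+ n).
  by elim: n => [|n IHn]; [exact: sub_closed0|rewrite mulrS; exact: sub_closedD].
by case: j => n; [exact: An|apply/sub_closedN/An].
Qed.

Lemma pair_mulrz x q j : (x, q) *~ j = (x *~ j, q *~ j).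
Proof.
have En n : (x, q) *+ n = (x *+ n, q *+ n).
  by elim: n => // n IHn; rewrite !mulrS IHn.
by case: j => n; rewrite -?pmulrn ?NegzE ?mulrNz -?pmulrn En.
Qed.

(** For a subgroup [A], this says that the first entry determines the second modulo integers: [A]
    represents a homomorphism from a subgroup of [G] to Q/Z. *)
Definition graph_of_character A := forall r, A (0, r) -> r \is a Num.int.

(** If some positive multiple of [x] lies in the domain, take the least such factor [d] and divide a
    value at [x *+ d] by [d]; this is the divisibility of Q/Z. Otherwise only the zero multiple
    imposes a condition, and [q = 0] serves. *)
Lemma extension_value x : graph_of_character A ->
  exists q, forall j r, A (x *~ j, r) -> r - q *~ j \is a Num.int.
Proof.
move=> intA.
have [ex|noex] := pselect (exists d : nat,
  (0 < d)%N && `[< exists q, A (x *+ d, q) >]).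
  case: (ex_minnP ex) => d /andP[d_gt0 /asboolP[q Aq]] min_d.
  exists (q / d%:R) => j r Ar.
  have dn0 : d%:R != 0 :> rat by rewrite pnatr_eq0 -lt0n.
  set l := (j %/ d)%Z.
  have jE : j = d%:Z * l + (j %% d)%Z by rewrite mulrC -divz_eq.
  have Amod : A (x *~ (j %% d)%Z, r - q *~ l).
    have := subA Ar (sub_closedMz l Aq); rewrite pair_mulrz; congr (A (_, _)).
    by rewrite {1}jE mulrzDr mulrzA -pmulrn addrAC subrr add0r.
  (* The remainder also takes [x] into the domain, so it vanishes by minimality of [d]. *)
  have mod0 : (j %% d)%Z = 0.
    have : (0 <= (j %% d)%Z < d)%R by rewrite modz_ge0 ?ltz_pmod // -lt0n.
    case: (j %% d)%Z Amod => // -[//|m] Am; rewrite /= ltz_nat => ltmd.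
    suff : (d <= m.+1)%N by rewrite leqNgt ltmd.
    by apply: min_d; apply/asboolP; exists (r - q *~ l).
  have -> : r - q / d%:R *~ j = r - q *~ l.
    by rewrite jE mod0 addr0 mulrzA -pmulrn -[_ *+ d]mulr_natr divfK.
  by apply: intA; rewrite -[0](mulr0z x) -mod0.
exists 0 => j r Ar; rewrite mul0rz subr0.
have j0 : j = 0.
  apply/eqP; apply: contra_notT noex => jn0; exists `|j|%N.
  rewrite absz_gt0 jn0; apply/asboolP.
  exists (r *~ Num.sg j); have := sub_closedMz (Num.sg j) Ar.
  by rewrite pair_mulrz -mulrzA mulrC -normrEsg -abszE pmulrn.
by apply: intA; rewrite -[0](mulr0z x) -j0.
Qed.

End SubClosed.

(** Zorn's lemma gives a maximal graph through [(b, t)], whose domain is all of [G] by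
    [extension_value]. Since [chi] picks rational representatives, it is additive only modulo
    integers. *)
Lemma character_extension (b : G) (t : rat) :
  (forall j, b *~ j = 0 -> t *~ j \is a Num.int) ->
  exists chi : G -> rat,
    (forall x y, chi (x - y) - (chi x - chi y) \is a Num.int) /\
    chi b - t \is a Num.int.
Proof.
move=> ordt.
(* Membership is asked of nonempty sets only: the union of the empty chain is empty and must be
   good. *)
pose good A := [/\ sub_closed A, graph_of_character A &
  A !=set0 -> A (b, t) /\ A (0, 1)].
have [F goodF chainF|A [[subA intA bA] maxA]] := @Zorn_bigcup _ good.
  have in2 u v : (\bigcup_(A in F) A) u -> (\bigcup_(A in F) A) v ->
      exists A, [/\ F A, A u & A v].
    move=> [A FA Au] [B FB Bv]; have [AB|BA] := chainF A B FA FB.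
      by exists B; split=> //; exact: AB.
    by exists A; split=> //; exact: BA.
  split=> [u v Uu Uv|r [A FA Ar]|[u [A FA Au]]].
  - have [A [FA Au Av]] := in2 u v Uu Uv.
    by exists A => //; have [subA _ _] := goodF A FA; exact: subA.
  - by have [_ intA _] := goodF A FA; exact: intA.
  - have [_ _ [|bA zA]] := goodF A FA; first by exists u.
    by split; exists A.
have A_neq0 : A !=set0.
  (* The subgroup generated by [(b, t)] and [(0, 1)] is good, so the empty set is not maximal. *)
  pose A0 : set (G * rat) :=
    [set u | exists i j, u = (b *~ i, t *~ i + j%:~R)].
  have goodA0 : good A0.
    split=> [_ _ [i [j ->]] [i' [j' ->]]|r [i [j [bi ->]]]|_].
    - exists (i - i'), (j - j'); congr (_, _) => /=; rewrite !mulrzBr //.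
      by rewrite opprD addrACA.
    - by rewrite rpredD ?intr_int // ordt.
    - split; [exists 1, 0|exists 0, 1]; first by rewrite !mulr1z addr0.
      by rewrite !mulr0z add0r.
  apply: contrapT => /set0P/negP; rewrite negbK => /eqP A0E.
  apply: (maxA A0) goodA0; rewrite A0E; split=> // /(_ (0, 0)).
  by apply; exists 0, 0; rewrite !mulr0z addr0.
have [btA zA] := bA A_neq0.
have total x : exists q, A (x, q).
  have [q intq] := extension_value subA A_neq0 x intA.
  (* Adjoining [(x, q)] keeps the set good, so by maximality [B] is contained in [A]. *)
  pose B : set (G * rat) :=
    [set u | exists2 v, A v & exists j, u = v + (x, q) *~ j].
  have subAB : A `<=` B.
    by move=> u Au; exists u => //; exists 0; rewrite mulr0z addr0.
  have goodB : good B.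
    split=> [_ _ [u Au [i ->]] [v Av [j ->]]|r [[y s] Au [j]]|_].
    - exists (u - v); first exact: subA.
      by exists (i - j); rewrite mulrzBr addrACA opprD.
    - rewrite pair_mulrz => -[yE ->].
      have /intq : A (x *~ j, - s).
        have := sub_closedN subA A_neq0 Au; congr (A (_, _)).
        by apply/esym/eqP; rewrite -subr_eq0 opprK addrC -yE.
      by rewrite -opprD rpredN.
    - by split; exact: subAB.
  have [BA|nBA] := pselect (B `<=` A).
    exists q; apply: BA; exists 0; first exact: sub_closed0.
    by exists 1; rewrite mulr1z add0r.
  by have := maxA B (conj subAB nBA).
have [chi Achi] := choice total.
exists chi; split=> [x y|]; apply: intA.
  have := subA _ _ (Achi (x - y)) (subA _ _ (Achi x) (Achi y)).
  by congr (A (_, _)); rewrite /= subrr.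
have := subA _ _ (Achi b) btA.
by congr (A (_, _)); rewrite /= subrr.
Qed.

End SubgroupExtension.

(** * Colourings from characters *)

Section CharacterColoring.

Local Open Scope ring_scope.

Lemma int_between_eq0 (q : rat) : q \is a Num.int -> -1 < q -> q < 1 -> q = 0.
Proof.
case/intrP=> i -> gti lti; have -> : i = 0; last by [].
move: gti lti; rewrite -[1]/(1%:~R) -intrN !ltr_int; lia.
Qed.

(** The colour of [x] is the integer part of [k] times the fractional part of [chi x]. A solution
    would give a representative [s] of [chi b] modulo integers with [|k s| < n <= k t]; then [s - t]
    would be an integer strictly between [-2t >= -1] and 0. *)
Lemma character_coloring (G : zmodType) (b : G) (k n : nat) (t : rat) :
    (0 < n)%N -> (forall j : int, b *~ j = 0 -> t *~ j \is a Num.int) ->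
    n%:R <= k%:R * t -> t <= 1 / 2%:R ->
  exists c : G -> 'I_k, ~ diff_sum (fun x y => c x = c y) n b.
Proof.
move=> n_gt0 /character_extension[chi [chiB chib]] le_nkt le_t.
have k_gt0 : 0 < k%:R :> rat.
  rewrite ltr0n lt0n; apply: contraTneq le_nkt => ->.
  by rewrite mul0r -ltNge ltr0n.
pose phi x := chi x - (Num.floor (chi x))%:~R.
have phi_int x : phi x - chi x \is a Num.int.
  by rewrite /phi addrAC subrr add0r rpredN intr_int.
have phi_ge0 x : 0 <= k%:R * phi x.
  by rewrite mulr_ge0 ?subr_ge0 ?floor_le // ltW.
have floor_phi x : exists i : 'I_k, Num.floor (k%:R * phi x) = i%:Z.
  have fl_ge0 : (0 <= Num.floor (k%:R * phi x))%R by rewrite floor_ge0.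
  have lt_k : (`|Num.floor (k%:R * phi x)| < k)%N.
    rewrite -ltz_nat gez0_abs // floor_lt_int -[ltRHS]mulr1 ltr_pM2l //.
    by rewrite /phi ltrBlDr addrC -[1]/(1%:~R) -intrD floorD1_gt.
  by exists (Ordinal lt_k); rewrite /= gez0_abs.
have [c cE] := choice floor_phi.
have int_eq (u v : rat) : u \is a Num.int -> u = v -> v \is a Num.int.
  by move=> ? <-.
exists c.
have mono x y : c x = c y ->
    exists s, chi (x - y) - s \is a Num.int /\ `|k%:R * s| < 1.
  move=> eqc; exists (phi x - phi y); split.
    by apply: int_eq
      (rpredD (rpredB (chiB x y) (phi_int x)) (phi_int y)) _; ring.
  have := floor_itv (k%:R * phi x); have := floor_itv (k%:R * phi y).
  rewrite !cE eqc intrD => /andP[? ?] /andP[? ?].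
  by rewrite mulrBr ltr_norml; apply/andP; split; lra.
(* The bound is not strict because of the case [m = 0]; strictness comes later from the first of the
   [n > 0] differences. *)
have bound m z : diff_sum (fun x y => c x = c y) m z ->
    exists s, chi z - s \is a Num.int /\ `|k%:R * s| <= m%:R.
  elim: m z => [|m IHm] z /=.
    move=> ->; exists 0; rewrite mulr0 normr0; split=> //.
    have := chiB 0 0; rewrite !subrr !subr0 //.
  move=> [x [y [/mono[s [ints les]] /IHm[s' [ints' les']]]]].
  exists (s + s'); split.
    by apply: int_eq (rpredB (rpredD ints ints') (chiB z (x - y))) _; ring.
  rewrite mulrDr; apply: le_trans (ler_normD _ _) _.
  by rewrite -natr1; lra.
case: n n_gt0 le_nkt => // n _ le_nkt.
move=> [x [y [/mono[s [ints les]] /bound[s' [ints' les']]]]].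
have ltss : `|k%:R * (s + s')| < n.+1%:R.
  rewrite mulrDr; apply: le_lt_trans (ler_normD _ _) _.
  by rewrite -natr1; lra.
have int_st : s + s' - t \is a Num.int.
  apply: int_eq
    (rpredB chib (rpredB (rpredD ints ints') (chiB b (x - y)))) _; ring.
have := ltr_normlP _ _ (lt_le_trans ltss le_nkt).
rewrite -mulrN !ltr_pM2l // => -[lt1 lt2].
have st0 : s + s' - t = 0 by apply: int_between_eq0 => //; lra.
lra.
Qed.

Lemma ord_Some_dvd (G : zmodType) (b : G) m (j : int) :
  ord b = Some m -> b *~ j = 0 -> (m %| j)%Z.
Proof.
rewrite /ord; case: pselect => // ex [<-]; case: ex_minnP => d.
case/andP=> d_gt0 /eqP bd min_d bj.
rewrite (sameP dvdz_mod0P eqP).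
have : b *~ (j %% d)%Z = 0.
  move: bj; rewrite {1}(divz_eq j d) mulrzDr mulrC mulrzA.
  by rewrite -pmulrn bd mul0rz add0r.
have : 0 <= (j %% d)%Z < d by rewrite modz_ge0 ?ltz_pmod // -lt0n.
case: (j %% d)%Z => // -[//|i] /=; rewrite ltz_nat => ltid bi.
suff : (d <= i.+1)%N by rewrite leqNgt ltid.
by apply: min_d; rewrite pmulrn bi eqxx.
Qed.

Lemma ord_Some_mulrn (G : zmodType) (b : G) m : ord b = Some m -> b *+ m = 0.
Proof.
rewrite /ord; case: pselect => // ex [<-]; case: ex_minnP => d.
by case/andP=> _ /eqP.
Qed.

Lemma ord_None_eq0 (G : zmodType) (b : G) (j : int) :
  ord b = None -> b *~ j = 0 -> j = 0.
Proof.
rewrite /ord; case: pselect => // noex _ bj.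
apply/eqP; apply: contra_notT noex => jn0; exists `|j|%N.
by rewrite absz_gt0 jn0 pmulrn abszE normrEsg mulrC mulrzA bj mul0rz eqxx.
Qed.

Lemma mulrz_div_int (p q : nat) (j : int) : (0 < q)%N ->
  (q %| j)%Z -> (p%:R / q%:R : rat) *~ j \is a Num.int.
Proof.
move=> q_gt0 /dvdzP[i ->].
have qn0 : q%:R != 0 :> rat by rewrite pnatr_eq0 -lt0n.
rewrite [i * _]mulrC mulrzA -pmulrn -[_ *+ q]mulr_natr divfK //.
by rewrite -mulrzl rpredM ?intr_int ?rpred_nat.
Qed.

(** The value [t] is [1/2], or [(p - 1)/(2p)] written as [p./2 / p]; it is admissible because 2,
    respectively [p], divides every [j] that annihilates [b]. The number of colours is the least [k]
    with [n <= k t]. *)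
Lemma ord_coloring (G : zmodType) (b : G) (n : nat) : (0 < n)%N -> b <> 0 ->
  exists c : G -> 'I_(num_colors n (ord b)),
    ~ diff_sum (fun x y => c x = c y) n b.
Proof.
move=> n_gt0 b_neq0.
have half_le : n%:R <= (2 * n)%:R * (1%:R / 2%:R) :> rat by rewrite natrM; lra.
case ordb: (ord b) => [m|]; last first.
  apply: character_coloring half_le _ => // j /(ord_None_eq0 ordb) ->.
  by rewrite mulr0z.
rewrite /num_colors; case: ifP => [m_even|m_odd].
  apply: character_coloring half_le _ => // j /(ord_Some_dvd ordb) mj.
  apply: mulrz_div_int => //; apply: dvdz_trans mj; exact: m_even.
(* The value 0 is excluded because 2 divides it, the value 1 because [b] is nonzero. *)
have m_gt1 : (1 < m)%N.
  case: m ordb m_odd => [|[|m]] // ordb _.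
  by case: b_neq0; apply: (ord_Some_mulrn ordb).
set p := max_pdiv m; have p_pr : prime p by exact: max_pdiv_prime.
have p_gt2 : (2 < p)%N.
  rewrite ltn_neqAle prime_gt1 // andbT; apply: contraFneq m_odd => ->.
  exact: max_pdiv_dvd.
have p_odd : odd p by case/even_prime: p_pr p_gt2 => [->|].
apply: (@character_coloring _ _ _ _ (p./2%:R / p%:R)) => //.
- move=> j /(ord_Some_dvd ordb) mj.
  apply: mulrz_div_int; first exact: ltnW (ltnW p_gt2).
  by apply: dvdz_trans mj; exact: max_pdiv_dvd.
- have p1_gt0 : 0 < p%:R - 1 :> rat by rewrite subr_gt0 ltr1n ltnW.
  have p_gt0 : 0 < p%:R :> rat by lra.
  have halfE : p%:R = 2%:R * p./2%:R + 1 :> rat.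
    by rewrite -{1}(odd_double_half p) p_odd natrD addrC -muln2 natrM mulrC.
  set q := (2 * n * p)%:R / (p%:R - 1) : rat.
  have q_ge0 : 0 <= q by rewrite divr_ge0 // ltW.
  (* The ceiling is nonnegative, so the absolute value in [num_colors] leaves it unchanged. *)
  have le_q : q <= `|Num.ceil q|%:R.
    rewrite -[leRHS]/((Posz _)%:~R) gez0_abs ?ceil_ge //.
    by rewrite ceil_ge0 (lt_le_trans _ q_ge0).
  apply: le_trans (ler_wpM2r _ le_q); last by rewrite divr_ge0.
  (* Before rounding up, the inequality between [n] and [k t] is an equality. *)
  suff -> : q * (p./2%:R / p%:R) = n%:R by [].
  rewrite /q !natrM halfE; rewrite halfE in p_gt0 p1_gt0.
  by field; rewrite !gt_eqF.
- rewrite ler_pdivrMr ?ltr0n; last exact: ltnW (ltnW p_gt2).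
  have : (p./2.*2 <= p)%N by rewrite -{2}(odd_double_half p) leq_addl.
  by rewrite -(ler_nat rat) -muln2 natrM; lra.
Qed.

End CharacterColoring.

Theorem proposition3p0p7 (n : nat) (n_gt0 : 0 < n)
    (G : zmodType) (e : G -> nat) (G_computable : computable_group e)
    (b : G) (b_neq0 : b <> 0%R)
    (X : nat -> nat) (X_PA : PA_degree X) :
  exists2 c : G -> 'I_(num_colors n (ord b)),
    computable_coloring_in X e c &
    ~ exists x y : 'I_n -> G,
        pairwise_monochromatic c x y /\ (\sum_(i < n) (x i - y i) = b)%R.
Proof.
have [c nc] := ord_coloring n_gt0 b_neq0.
have k_gt0 : 0 < num_colors n (ord b) by exact: leq_ltn_trans (ltn_ord (c b)).
have [c' Cc' nc'] :=
  PA_degree_coloring G_computable k_gt0 X_PA (ex_intro _ c nc).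
by exists c' => // sol; apply: nc'; apply/diff_sumP.
Qed.
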